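(* Let a natural deduction theory with classifier $p:\mathbb P\to\mathbf{ctx}$ be given, with entailment classifier $e:\mathbb E\to\mathbf{ctx}$. Interaction of arrows and products in $\mathbb P$ lifts to $\mathbb E$ in the sense that the rule $$\frac{x;\psi\vdash\phi\qquad x;\bot\vdash\chi}{x;\psi\wedge\chi\vdash\phi\wedge\chi}\ (F)$$ is in the theory. That is, there is a functor $f:\mathbb E\times_{\mathbf{ctx}}\mathbb P\to\mathbb E$ belonging to the rules $\mathscr R$ of the theory that sends a pair $(\psi\to\phi,\chi)$ over $x$ to a vertical arrow $\psi\wedge\chi\to\phi\wedge\chi$ over $x$.
   Context: Judgemental theory: a category $\mathbf{ctx}$ with terminal object, a set $\mathscr R$ of functors (''rules''), of which those with codomain $\mathbf{ctx}$ are the ''judgements'' $\mathscr J$, and a set $\mathscr P$ of natural transformations (''policies'') filling triangles of rules, such that: $\mathscr R,\mathscr P$ are closed under composition and under finite limits (pullbacks, equalizers, finite powers $\mathcal X^n$ and arrow categories $\mathcal X^{\mathsf 2}$ with $\mathrm{dom},\mathrm{cod}$ and the tautological transformation $\mathrm{dom}\Rightarrow\mathrm{cod}$; projections and functors induced by the universal properties from cones made of rules (and policies) are again in $\mathscr R$), $\mathscr P$ is closed under whiskering with rules, and the theory is closed under $\sharp$-liftings: given rules $\lambda:\mathcal F\to\mathcal G$, $r:\mathcal F\to\mathcal X$, $r':\mathcal G\to\mathcal X$, a policy $\lambda^\sharp:r'\lambda\Rightarrow r$ and a rule $h:\mathcal H\to\mathcal X$ which is a fibration, the functor $\mathcal F\times_{\mathcal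 X}\mathcal H\to\mathcal G\times_{\mathcal X}\mathcal H$, $(F,H)\mapsto(\lambda F,H[\lambda^\sharp_F])$ is in $\mathscr R$, and the natural transformation with components the cartesian lifts $H[\lambda^\sharp_F]\to H$ is in $\mathscr P$ (and dually for opfibrations). Natural deduction theory (NDT): the judgemental theory generated by one classifier $p:\mathbb P\to\mathbf{ctx}$, where $\mathbf{ctx}$ is the category of finite sets and $p$ is a faithful fibration with fibered finite products $\wedge$, fibered implication and fibered initial objects (these operators, e.g. $\wedge:\mathbb P\times_{\mathbf{ctx}}\mathbb P\to\mathbb P$, being counted among the rules). It is required to be substitutional: judgement classifiers are fibrations, rules preserve cartesian maps, policies have cartesian components. Entailment classifier: let $I:\mathbf{ctx}\to\mathbf{ctx}^{\mathsf 2}$, $x\mapsto\mathrm{id}_x$; $\mathbb E$ is the pullback of $p^{\mathsf 2}:\mathbb P^{\mathsf 2}\to\mathbf{ctx}^{\mathsf 2}$ along $I$, i.e. the category of $p$-vertical arrows, with projection $e:\mathbb E\to\mathbf{ctx}$. The judgement $x;\psi\vdash\phi$ means that there is an object $\psi\to\phi$ of $\mathbb E$ over $x$; the premise $x;\bot\vdash\chi$ just records a formula $\chi\in\mathbb P$ over $x$. *)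

(* Defs.v *)
From mathcomp Require Import all_boot.
From Stdlib Require Import ProofIrrelevance FunctionalExtensionality.

Set Implicit Arguments.
Unset Strict Implicit.
Unset Printing Implicit Defensive.

(** * Categories, functors, natural transformations *)

Record Cat := MkCat {
  ob :> Type;
  hom : ob -> ob -> Type;
  idm : forall a, hom a a;
  comp : forall a b c, hom b c -> hom a b -> hom a c;
  comp_idl : forall a b (f : hom a b), comp (idm b) f = f;
  comp_idr : forall a b (f : hom a b), comp f (idm a) = f;
  comp_assoc : forall a b c d (h : hom c d) (g : hom b c) (f : hom a b),
    comp h (comp g f) = comp (comp h g) f
}.
Arguments hom {C} _ _ : rename.
Arguments idm {C} _ : rename.
Arguments comp {C a b c} _ _ : rename.

Declare Scope cat_scope.
Delimit Scope cat_scope with cat.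
Open Scope cat_scope.
Notation "g ∘ f" := (comp g f) (at level 40, left associativity) : cat_scope.

(* Equality of two arrows of [C] whose endpoints are only propositionally equal;
   it entails equality of the domains and of the codomains. *)
Inductive hom_eq (C : Cat) (a b : C) (f : hom a b) :
    forall c d : C, hom c d -> Prop :=
  hom_eq_refl : hom_eq f f.
Notation "f ≡ g" := (hom_eq f g) (at level 70, no associativity) : cat_scope.

Section HomEq.
Variable C : Cat.

Lemma hom_eqE (a b c d : C) (f : hom a b) (g : hom c d) : f ≡ g ->
  exists (e1 : c = a) (e2 : d = b),
    f = eq_rect c (fun x => hom x b) (eq_rect d (fun y => hom c y) g b e2) a e1.
Proof. by case; exists erefl, erefl. Qed.

Lemma hom_eq_eq (a b : C) (f g : hom a b) : f ≡ g -> f = g.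
Proof.
case/hom_eqE => e1 [e2 ->].
by rewrite (proof_irrelevance _ e1 erefl) (proof_irrelevance _ e2 erefl).
Qed.

Lemma eq_hom_eq (a b : C) (f g : hom a b) : f = g -> f ≡ g.
Proof. by move=> ->. Qed.

Lemma hom_eq_sym (a b c d : C) (f : hom a b) (g : hom c d) : f ≡ g -> g ≡ f.
Proof. by case. Qed.

Lemma hom_eq_trans (a b c d x y : C) (f : hom a b) (g : hom c d) (h : hom x y) :
  f ≡ g -> g ≡ h -> f ≡ h.
Proof. by case. Qed.

Lemma hom_eq_dom (a b c d : C) (f : hom a b) (g : hom c d) : f ≡ g -> a = c.
Proof. by case. Qed.

Lemma hom_eq_cod (a b c d : C) (f : hom a b) (g : hom c d) : f ≡ g -> b = d.
Proof. by case. Qed.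

Lemma hom_eq_id (a b : C) : a = b -> idm a ≡ idm b.
Proof. by move=> ->. Qed.

Lemma hom_eq_comp (a b c a' b' c' : C) (g : hom b c) (f : hom a b)
    (g' : hom b' c') (f' : hom a' b') :
  g ≡ g' -> f ≡ f' -> g ∘ f ≡ g' ∘ f'.
Proof.
move=> /hom_eqE[e1 [e2 ->]] /hom_eqE[e3 [e4 ->]].
destruct e2, e3, e1 => /=.
by rewrite (proof_irrelevance _ e4 erefl).
Qed.

End HomEq.

Record Functor (A B : Cat) := MkFunctor {
  fob :> A -> B;
  fmap : forall a b, hom a b -> hom (fob a) (fob b);
  fmap_id : forall a, fmap (idm a) = idm (fob a);
  fmap_comp : forall a b c (g : hom b c) (f : hom a b),
    fmap (g ∘ f) = fmap g ∘ fmap f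
}.
Arguments fmap {A B} _ {a b} _ : rename.

Lemma fmap_hom_eq (A B : Cat) (F : Functor A B) (a b c d : A)
  (f : hom a b) (g : hom c d) : f ≡ g -> fmap F f ≡ fmap F g.
Proof. by case. Qed.

Definition idF (A : Cat) : Functor A A :=
  @MkFunctor A A (fun a => a) (fun _ _ f => f)
    (fun _ => erefl) (fun _ _ _ _ _ => erefl).

Definition compF (A B C : Cat) (G : Functor B C) (F : Functor A B) :
  Functor A C.
Proof.
refine (@MkFunctor A C (fun a => G (F a)) (fun _ _ f => fmap G (fmap F f)) _ _).
- by move=> a; rewrite !fmap_id.
- by move=> a b c g f; rewrite !fmap_comp.
Defined.
Notation "G ⊚ F" := (compF G F) (at level 40, left associativity) : cat_scope.

Definition feq (A B : Cat) (F G : Functor A B) : Prop :=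
  (forall a, F a = G a) /\ (forall a b (f : hom a b), fmap F f ≡ fmap G f).
Notation "F ≗ G" := (feq F G) (at level 70, no associativity) : cat_scope.

Record NatTrans (A B : Cat) (F G : Functor A B) := MkNatTrans {
  nt :> forall a, hom (F a) (G a);
  nt_nat : forall a b (f : hom a b), fmap G f ∘ nt a = nt b ∘ fmap F f
}.
Notation "F ⇒ G" := (NatTrans F G) (at level 90, right associativity) : cat_scope.

Definition idN (A B : Cat) (F : Functor A B) : F ⇒ F.
Proof.
refine (@MkNatTrans A B F F (fun a => idm (F a)) _).
by move=> a b f; rewrite comp_idl comp_idr.
Defined.

Definition compN (A B : Cat) (F G H : Functor A B) (β : G ⇒ H) (α : F ⇒ G) :
  F ⇒ H.
Proof.
refine (@MkNatTrans A B F H (fun a => β a ∘ α a) _).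
by move=> a b f; rewrite comp_assoc nt_nat -!comp_assoc nt_nat.
Defined.

Definition whiskL (A B C : Cat) (L : Functor B C) (F G : Functor A B)
  (α : F ⇒ G) : L ⊚ F ⇒ L ⊚ G.
Proof.
refine (@MkNatTrans A C (L ⊚ F) (L ⊚ G) (fun a => fmap L (α a)) _).
by move=> a b f /=; rewrite -!fmap_comp nt_nat.
Defined.

Definition whiskR (A B C : Cat) (F G : Functor B C) (α : F ⇒ G)
  (R : Functor A B) : F ⊚ R ⇒ G ⊚ R.
Proof.
refine (@MkNatTrans A C (F ⊚ R) (G ⊚ R) (fun a => α (R a)) _).
by move=> a b f /=; rewrite nt_nat.
Defined.

Definition has_terminal (C : Cat) : Prop :=
  exists t : C, forall a : C, exists! _ : hom a t, True.

(** * Finite limits of categories *)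

Section Pullback.
Variables (A B X : Cat) (F : Functor A X) (G : Functor B X).

Record PbOb := MkPbOb { pb1 : A; pb2 : B; pb_eq : F pb1 = G pb2 }.

Record PbHom (k l : PbOb) := MkPbHom {
  pbm1 : hom (pb1 k) (pb1 l);
  pbm2 : hom (pb2 k) (pb2 l);
  pbm_eq : fmap F pbm1 ≡ fmap G pbm2
}.

Lemma PbHom_ext k l (f g : PbHom k l) :
  pbm1 f = pbm1 g -> pbm2 f = pbm2 g -> f = g.
Proof.
case: f g => f1 f2 e [g1 g2 e'] /= h1 h2; subst g1 g2.
by rewrite (proof_irrelevance _ e e').
Qed.

Definition pb_id k : PbHom k k.
Proof.
refine (@MkPbHom k k (idm _) (idm _) _).
by rewrite !fmap_id; apply: hom_eq_id; exact: pb_eq.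
Defined.

Definition pb_comp k l m (g : PbHom l m) (f : PbHom k l) : PbHom k m.
Proof.
refine (@MkPbHom k m (pbm1 g ∘ pbm1 f) (pbm2 g ∘ pbm2 f) _).
by rewrite !fmap_comp; apply: hom_eq_comp; exact: pbm_eq.
Defined.

Definition Pb : Cat.
Proof.
refine (@MkCat PbOb PbHom pb_id pb_comp _ _ _).
- by move=> *; apply: PbHom_ext; rewrite /= comp_idl.
- by move=> *; apply: PbHom_ext; rewrite /= comp_idr.
- by move=> *; apply: PbHom_ext; rewrite /= comp_assoc.
Defined.

Definition pb_fst : Functor Pb A :=
  @MkFunctor Pb A pb1 pbm1 (fun _ => erefl) (fun _ _ _ _ _ => erefl).
Definition pb_snd : Functor Pb B :=
  @MkFunctor Pb B pb2 pbm2 (fun _ => erefl) (fun _ _ _ _ _ => erefl).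

Definition pb_lift (K : Cat) (U : Functor K A) (V : Functor K B)
  (e : F ⊚ U ≗ G ⊚ V) : Functor K Pb.
Proof.
refine (@MkFunctor K Pb (fun k => @MkPbOb (U k) (V k) (proj1 e k))
  (fun k l f => @MkPbHom (MkPbOb (proj1 e k)) (MkPbOb (proj1 e l))
     (fmap U f) (fmap V f) (proj2 e k l f)) _ _).
- by move=> a; apply: PbHom_ext; rewrite /= fmap_id.
- by move=> *; apply: PbHom_ext; rewrite /= fmap_comp.
Defined.

Definition pb_lift2 (K : Cat) (U U' : Functor K A) (V V' : Functor K B)
  (e : F ⊚ U ≗ G ⊚ V) (e' : F ⊚ U' ≗ G ⊚ V')
  (α : U ⇒ U') (β : V ⇒ V') (h : forall k, fmap F (α k) ≡ fmap G (β k)) :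
  pb_lift e ⇒ pb_lift e'.
Proof.
refine (@MkNatTrans K Pb (pb_lift e) (pb_lift e')
  (fun k => @MkPbHom (pb_lift e k) (pb_lift e' k) (α k) (β k) (h k)) _).
by move=> *; apply: PbHom_ext; rewrite /= nt_nat.
Defined.

End Pullback.

Section Equalizer.
Variables (A B : Cat) (F G : Functor A B).

Record EqOb := MkEqOb { eq1 : A; eq_eq : F eq1 = G eq1 }.

Record EqHom (k l : EqOb) := MkEqHom {
  eqm1 : hom (eq1 k) (eq1 l);
  eqm_eq : fmap F eqm1 ≡ fmap G eqm1
}.

Lemma EqHom_ext k l (f g : EqHom k l) : eqm1 f = eqm1 g -> f = g.
Proof.
case: f g => f1 e [g1 e'] /= h; subst g1.
by rewrite (proof_irrelevance _ e e').
Qed.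

Definition eq_id k : EqHom k k.
Proof.
refine (@MkEqHom k k (idm _) _).
by rewrite !fmap_id; apply: hom_eq_id; exact: eq_eq.
Defined.

Definition eq_comp k l m (g : EqHom l m) (f : EqHom k l) : EqHom k m.
Proof.
refine (@MkEqHom k m (eqm1 g ∘ eqm1 f) _).
by rewrite !fmap_comp; apply: hom_eq_comp; exact: eqm_eq.
Defined.

Definition Eqz : Cat.
Proof.
refine (@MkCat EqOb EqHom eq_id eq_comp _ _ _).
- by move=> *; apply: EqHom_ext; rewrite /= comp_idl.
- by move=> *; apply: EqHom_ext; rewrite /= comp_idr.
- by move=> *; apply: EqHom_ext; rewrite /= comp_assoc.
Defined.

Definition eq_incl : Functor Eqz A :=
  @MkFunctor Eqz A eq1 eqm1 (fun _ => erefl) (fun _ _ _ _ _ => erefl).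

Definition eq_lift (K : Cat) (U : Functor K A) (e : F ⊚ U ≗ G ⊚ U) :
  Functor K Eqz.
Proof.
refine (@MkFunctor K Eqz (fun k => @MkEqOb (U k) (proj1 e k))
  (fun k l f => @MkEqHom (MkEqOb (proj1 e k)) (MkEqOb (proj1 e l))
     (fmap U f) (proj2 e k l f)) _ _).
- by move=> a; apply: EqHom_ext; rewrite /= fmap_id.
- by move=> *; apply: EqHom_ext; rewrite /= fmap_comp.
Defined.

Definition eq_lift2 (K : Cat) (U U' : Functor K A)
  (e : F ⊚ U ≗ G ⊚ U) (e' : F ⊚ U' ≗ G ⊚ U')
  (α : U ⇒ U') (h : forall k, fmap F (α k) ≡ fmap G (α k)) :
  eq_lift e ⇒ eq_lift e'.
Proof.
refine (@MkNatTrans K Eqz (eq_lift e) (eq_lift e')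
  (fun k => @MkEqHom (eq_lift e k) (eq_lift e' k) (α k) (h k)) _).
by move=> *; apply: EqHom_ext; rewrite /= nt_nat.
Defined.

End Equalizer.

Section Power.
Variables (X : Cat) (n : nat).

Definition Pow : Cat.
Proof.
refine (@MkCat ('I_n -> X) (fun x y => forall i, hom (x i) (y i))
  (fun x i => idm (x i)) (fun x y z g f i => g i ∘ f i) _ _ _).
- by move=> *; apply: functional_extensionality_dep => i; rewrite comp_idl.
- by move=> *; apply: functional_extensionality_dep => i; rewrite comp_idr.
- by move=> *; apply: functional_extensionality_dep => i; rewrite comp_assoc.
Defined.

Definition pow_proj (i : 'I_n) : Functor Pow X :=
  @MkFunctor Pow X (fun x => x i) (fun _ _ f => f i)
    (fun _ => erefl) (fun _ _ _ _ _ => erefl).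

Definition pow_lift (K : Cat) (U : 'I_n -> Functor K X) : Functor K Pow.
Proof.
refine (@MkFunctor K Pow (fun k i => U i k) (fun k l f i => fmap (U i) f) _ _).
- by move=> a; apply: functional_extensionality_dep => i; rewrite fmap_id.
- by move=> *; apply: functional_extensionality_dep => i; rewrite fmap_comp.
Defined.

Definition pow_lift2 (K : Cat) (U U' : 'I_n -> Functor K X)
  (α : forall i, U i ⇒ U' i) : pow_lift U ⇒ pow_lift U'.
Proof.
refine (@MkNatTrans K Pow (pow_lift U) (pow_lift U') (fun k i => α i k) _).
by move=> *; apply: functional_extensionality_dep => i /=; rewrite nt_nat.
Defined.

End Power.

Section Arrow.
Variable X : Cat.

Record ArrOb := MkArrOb { adom : X; acod : X; aarr : hom adom acod }.

Record ArrHom (k l : ArrOb) := MkArrHom {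
  am0 : hom (adom k) (adom l);
  am1 : hom (acod k) (acod l);
  am_sq : am1 ∘ aarr k = aarr l ∘ am0
}.

Lemma ArrHom_ext k l (f g : ArrHom k l) : am0 f = am0 g -> am1 f = am1 g -> f = g.
Proof.
case: f g => f1 f2 e [g1 g2 e'] /= h1 h2; subst g1 g2.
by rewrite (proof_irrelevance _ e e').
Qed.

Definition arr_id k : ArrHom k k.
Proof.
refine (@MkArrHom k k (idm _) (idm _) _).
by rewrite comp_idl comp_idr.
Defined.

Definition arr_comp k l m (g : ArrHom l m) (f : ArrHom k l) : ArrHom k m.
Proof.
refine (@MkArrHom k m (am0 g ∘ am0 f) (am1 g ∘ am1 f) _).
by rewrite -comp_assoc am_sq comp_assoc am_sq comp_assoc.
Defined.

Definition Arr : Cat.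
Proof.
refine (@MkCat ArrOb ArrHom arr_id arr_comp _ _ _).
- by move=> *; apply: ArrHom_ext; rewrite /= comp_idl.
- by move=> *; apply: ArrHom_ext; rewrite /= comp_idr.
- by move=> *; apply: ArrHom_ext; rewrite /= comp_assoc.
Defined.

Definition arr_dom : Functor Arr X :=
  @MkFunctor Arr X adom am0 (fun _ => erefl) (fun _ _ _ _ _ => erefl).
Definition arr_cod : Functor Arr X :=
  @MkFunctor Arr X acod am1 (fun _ => erefl) (fun _ _ _ _ _ => erefl).

Definition arr_taut : arr_dom ⇒ arr_cod :=
  @MkNatTrans Arr X arr_dom arr_cod aarr (fun _ _ f => am_sq f).

Definition arr_lift (K : Cat) (F G : Functor K X) (α : F ⇒ G) : Functor K Arr.
Proof.
refine (@MkFunctor K Arr (fun k => MkArrOb (α k))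
  (fun k l f => @MkArrHom (MkArrOb (α k)) (MkArrOb (α l))
     (fmap F f) (fmap G f) (nt_nat α f)) _ _).
- by move=> a; apply: ArrHom_ext; rewrite /= fmap_id.
- by move=> *; apply: ArrHom_ext; rewrite /= fmap_comp.
Defined.

Definition arr_lift2 (K : Cat) (F G F' G' : Functor K X)
  (α : F ⇒ G) (α' : F' ⇒ G') (β : F ⇒ F') (γ : G ⇒ G')
  (h : forall k, γ k ∘ α k = α' k ∘ β k) : arr_lift α ⇒ arr_lift α'.
Proof.
refine (@MkNatTrans K Arr (arr_lift α) (arr_lift α')
  (fun k => @MkArrHom (arr_lift α k) (arr_lift α' k) (β k) (γ k) (h k)) _).
by move=> *; apply: ArrHom_ext; rewrite /= nt_nat.
Defined.

End Arrow.
Arguments arr_dom {X}.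
Arguments arr_cod {X}.
Arguments arr_taut {X}.

Definition arr_map (A B : Cat) (F : Functor A B) : Functor (Arr A) (Arr B) :=
  arr_lift (whiskL F arr_taut).

Definition arr_const (X : Cat) : Functor X (Arr X) := arr_lift (idN (idF X)).

(** * Fibrations *)

Section Fibration.
Variables (E B : Cat) (p : Functor E B).

Definition vertical (a b : E) (f : hom a b) : Prop := fmap p f ≡ idm (p a).

Definition cartesian (a b : E) (f : hom a b) : Prop :=
  forall (c : E) (g : hom c b) (w : hom (p c) (p a)),
    fmap p g = fmap p f ∘ w ->
    exists! h : hom c a, fmap p h = w /\ f ∘ h = g.

Definition opcartesian (a b : E) (f : hom a b) : Prop :=
  forall (c : E) (g : hom a c) (w : hom (p b) (p c)),
    fmap p g = w ∘ fmap p f ->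
    exists! h : hom b c, fmap p h = w /\ h ∘ f = g.

Definition fibration : Prop :=
  forall (b : E) (x : B) (u : hom x (p b)),
    exists (a : E) (f : hom a b), fmap p f ≡ u /\ cartesian f.

Definition opfibration : Prop :=
  forall (a : E) (x : B) (u : hom (p a) x),
    exists (b : E) (f : hom a b), fmap p f ≡ u /\ opcartesian f.

Definition faithful : Prop :=
  forall (a b : E) (f g : hom a b), fmap p f = fmap p g -> f = g.

End Fibration.

Definition preserves_cartesian (E E' B : Cat) (p : Functor E B)
  (q : Functor E' B) (F : Functor E E') : Prop :=
  forall (a b : E) (f : hom a b), cartesian p f -> cartesian q (fmap F f).

Definition fibred_functor (E E' B : Cat) (p : Functor E B)
  (q : Functor E' B) (F : Functor E E') : Prop :=
  q ⊚ F ≗ p /\ preserves_cartesian p q F.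

(** * Judgemental theories *)

Definition rule_class := forall A B : Cat, Functor A B -> Prop.
Definition policy_class :=
  forall (A B : Cat) (F G : Functor A B), (F ⇒ G) -> Prop.

Section Closure.
Variables (R : rule_class) (P : policy_class).

(* [X] is one of the categories of the theory. *)
Definition in_theory (X : Cat) : Prop := R (idF X).

Record closed_composition : Prop := {
  cc_dom : forall A B (F : Functor A B), R F -> in_theory A;
  cc_cod : forall A B (F : Functor A B), R F -> in_theory B;
  cc_comp : forall A B C (G : Functor B C) (F : Functor A B),
    R G -> R F -> R (G ⊚ F);
  cc_id2 : forall A B (F : Functor A B), R F -> P (idN F);
  cc_comp2 : forall A B (F G H : Functor A B) (β : G ⇒ H) (α : F ⇒ G),
    P β -> P α -> P (compN β α);
  cc_whiskL : forall A B C (L : Functor B C) (F G : Functor A B) (α : F ⇒ G),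
    R L -> P α -> P (whiskL L α);
  cc_whiskR : forall A B C (F G : Functor B C) (α : F ⇒ G) (L : Functor A B),
    P α -> R L -> P (whiskR α L)
}.

Record closed_pullbacks : Prop := {
  cp_fst : forall A B X (F : Functor A X) (G : Functor B X),
    R F -> R G -> R (pb_fst F G);
  cp_snd : forall A B X (F : Functor A X) (G : Functor B X),
    R F -> R G -> R (pb_snd F G);
  cp_lift : forall A B X (F : Functor A X) (G : Functor B X) K
      (U : Functor K A) (V : Functor K B) (e : F ⊚ U ≗ G ⊚ V),
    R F -> R G -> R U -> R V -> R (pb_lift e);
  cp_lift2 : forall A B X (F : Functor A X) (G : Functor B X) K
      (U U' : Functor K A) (V V' : Functor K B)
      (e : F ⊚ U ≗ G ⊚ V) (e' : F ⊚ U' ≗ G ⊚ V')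
      (α : U ⇒ U') (β : V ⇒ V') (h : forall k, fmap F (α k) ≡ fmap G (β k)),
    R F -> R G -> P α -> P β -> P (pb_lift2 e e' h)
}.

Record closed_equalizers : Prop := {
  ce_incl : forall A B (F G : Functor A B), R F -> R G -> R (eq_incl F G);
  ce_lift : forall A B (F G : Functor A B) K (U : Functor K A)
      (e : F ⊚ U ≗ G ⊚ U),
    R F -> R G -> R U -> R (eq_lift e);
  ce_lift2 : forall A B (F G : Functor A B) K (U U' : Functor K A)
      (e : F ⊚ U ≗ G ⊚ U) (e' : F ⊚ U' ≗ G ⊚ U')
      (α : U ⇒ U') (h : forall k, fmap F (α k) ≡ fmap G (α k)),
    R F -> R G -> P α -> P (eq_lift2 e e' h)
}.

Record closed_powers : Prop := {
  cw_proj : forall X n (i : 'I_n), in_theory X -> R (@pow_proj X n i);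
  cw_lift : forall X n K (U : 'I_n -> Functor K X),
    in_theory X -> in_theory K -> (forall i, R (U i)) -> R (pow_lift U);
  cw_lift2 : forall X n K (U U' : 'I_n -> Functor K X)
      (α : forall i, U i ⇒ U' i),
    in_theory X -> in_theory K -> (forall i, P (α i)) -> P (pow_lift2 α)
}.

Record closed_arrows : Prop := {
  ca_dom : forall X, in_theory X -> R (@arr_dom X);
  ca_cod : forall X, in_theory X -> R (@arr_cod X);
  ca_taut : forall X, in_theory X -> P (@arr_taut X);
  ca_lift : forall X K (F G : Functor K X) (α : F ⇒ G),
    P α -> R (arr_lift α);
  ca_lift2 : forall X K (F G F' G' : Functor K X)
      (α : F ⇒ G) (α' : F' ⇒ G') (β : F ⇒ F') (γ : G ⇒ G')
      (h : forall k, γ k ∘ α k = α' k ∘ β k),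
    P α -> P α' -> P β -> P γ -> P (arr_lift2 h)
}.

(* Here [L] is (F, H) |-> (λ F, H[λ♯_F]) and [σ] has the cartesian lifts
   H[λ♯_F] -> H as components.  No cleavage is fixed: every choice of
   cartesian lifts gives a rule and a policy. *)
Definition closed_sharp_lifting : Prop :=
  forall (F G X H : Cat) (λ : Functor F G) (r : Functor F X) (r' : Functor G X)
    (λs : r' ⊚ λ ⇒ r) (h : Functor H X)
    (L : Functor (Pb r h) (Pb r' h))
    (σ : pb_snd r' h ⊚ L ⇒ pb_snd r h),
  R λ -> R r -> R r' -> P λs -> R h -> fibration h ->
  pb_fst r' h ⊚ L ≗ λ ⊚ pb_fst r h ->
  (forall k : Pb r h, fmap h (σ k) ≡ λs (pb1 k) /\ cartesian h (σ k)) ->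
  R L /\ P σ.

Definition closed_sharp_oplifting : Prop :=
  forall (F G X H : Cat) (λ : Functor F G) (r : Functor F X) (r' : Functor G X)
    (λs : r ⇒ r' ⊚ λ) (h : Functor H X)
    (L : Functor (Pb r h) (Pb r' h))
    (σ : pb_snd r h ⇒ pb_snd r' h ⊚ L),
  R λ -> R r -> R r' -> P λs -> R h -> opfibration h ->
  pb_fst r' h ⊚ L ≗ λ ⊚ pb_fst r h ->
  (forall k : Pb r h, fmap h (σ k) ≡ λs (pb1 k) /\ opcartesian h (σ k)) ->
  R L /\ P σ.

End Closure.

Record judgemental_theory (ctx : Cat) := {
  jt_terminal : has_terminal ctx;
  rule : rule_class;
  policy : policy_class;
  (* A policy α : F ⇒ G fills the triangle of rules F, G and [idF B]. *)
  policy_rules : forall A B (F G : Functor A B) (α : F ⇒ G),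
    policy α -> rule F /\ rule G;
  jt_composition : closed_composition rule policy;
  jt_pullbacks : closed_pullbacks rule policy;
  jt_equalizers : closed_equalizers rule policy;
  jt_powers : closed_powers rule policy;
  jt_arrows : closed_arrows rule policy;
  jt_sharp : closed_sharp_lifting rule policy;
  jt_opsharp : closed_sharp_oplifting rule policy
}.
Arguments rule {ctx} _ {A B} _.
Arguments policy {ctx} _ {A B F G} _.

Definition judgement (ctx : Cat) (T : judgemental_theory ctx) (A : Cat)
  (j : Functor A ctx) : Prop := rule T j.

(* [T] is the least judgemental theory on [ctx] whose rules include [gen]. *)
Definition generated_by (ctx : Cat) (T : judgemental_theory ctx)
  (gen : rule_class) : Prop :=
  (forall A B (F : Functor A B), gen A B F -> rule T F) /\
  (forall T' : judgemental_theory ctx,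
     (forall A B (F : Functor A B), gen A B F -> rule T' F) ->
     (forall A B (F : Functor A B), rule T F -> rule T' F) /\
     (forall A B (F G : Functor A B) (α : F ⇒ G),
        policy T α -> policy T' α)).

(** * Natural deduction theories *)

Definition FinSet : Cat.
Proof.
refine (@MkCat finType (fun A B => {ffun A -> B}) (fun A => [ffun x => x])
  (fun A B C g f => [ffun x => g (f x)]) _ _ _).
- by move=> A B f; apply/ffunP => x; rewrite !ffunE.
- by move=> A B f; apply/ffunP => x; rewrite !ffunE.
- by move=> A B C D h g f; apply/ffunP => x; rewrite !ffunE.
Defined.

Section Connectives.
Variables (E B : Cat) (p : Functor E B).

Definition fibred_terminal (top : Functor B E) : Prop :=
  fibred_functor (idF B) p top /\
  forall a : E, exists! f : hom a (top (p a)), vertical p f.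

Definition fibred_initial (bot : Functor B E) : Prop :=
  fibred_functor (idF B) p bot /\
  forall a : E, exists! f : hom (bot (p a)) a, vertical p f.

Definition fibred_product (and : Functor (Pb p p) E) : Prop :=
  fibred_functor (p ⊚ pb_fst p p) p and /\
  exists (π1 : and ⇒ pb_fst p p) (π2 : and ⇒ pb_snd p p),
    forall k : Pb p p,
      vertical p (π1 k) /\ vertical p (π2 k) /\
      forall (c : E) (f : hom c (pb1 k)) (g : hom c (pb2 k)),
        vertical p f -> vertical p g ->
        exists! h : hom c (and k),
          vertical p h /\ π1 k ∘ h = f /\ π2 k ∘ h = g.

(* The fibrewise opposite of a faithful fibration [p]: an arrow a -> a' over
   u is the assertion u^* a' <= a in the fibre over [p a], tested against all
   arrows into a' that factor through u on the base. *)
Definition opp_rel (a a' : E) (u : hom (p a) (p a')) : Prop :=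
  forall (z : E) (w : hom (p z) (p a)),
    (exists g : hom z a', fmap p g = u ∘ w) -> exists h : hom z a, fmap p h = w.

Definition opp_hom (a a' : E) : Type := {u : hom (p a) (p a') | opp_rel u}.

Lemma opp_hom_ext a a' (f g : opp_hom a a') : sval f = sval g -> f = g.
Proof.
case: f g => u hu [v hv] /= e; subst v.
by rewrite (proof_irrelevance _ hu hv).
Qed.

Definition opp_id a : opp_hom a a.
Proof.
exists (idm (p a)) => z w [g e].
by exists g; rewrite e comp_idl.
Defined.

Definition opp_comp a b c (g : opp_hom b c) (f : opp_hom a b) : opp_hom a c.
Proof.
exists (sval g ∘ sval f) => z w [k e].
apply: (svalP f); apply: (svalP g).
by exists k; rewrite e comp_assoc.
Defined.

Definition FibOpp : Cat.
Proof.
refine (@MkCat E opp_hom opp_id opp_comp _ _ _).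
- by move=> *; apply: opp_hom_ext; rewrite /= comp_idl.
- by move=> *; apply: opp_hom_ext; rewrite /= comp_idr.
- by move=> *; apply: opp_hom_ext; rewrite /= comp_assoc.
Defined.

Definition fib_opp : Functor FibOpp B :=
  @MkFunctor FibOpp B (fun a => p a) (fun a b f => sval f)
    (fun _ => erefl) (fun _ _ _ _ _ => erefl).

(* For ψ, χ in one fibre, evaluation (ψ ⇒ χ) ∧ ψ -> χ is universal.  [ki] is
   the pair (imp k, ψ), and [m] ranges over the (unique) pair (h, id_ψ). *)
Definition fibred_implication (and : Functor (Pb p p) E)
  (imp : Functor (Pb fib_opp p) E) : Prop :=
  fibred_functor (p ⊚ pb_snd fib_opp p) p imp /\
  forall (k : Pb fib_opp p) (ki : Pb p p),
    pb1 ki = imp k -> pb2 ki = pb1 k ->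
    exists ev : hom (and ki) (pb2 k), vertical p ev /\
      forall (kz : Pb p p) (e : pb2 kz = pb2 ki) (g : hom (and kz) (pb2 k)),
        vertical p g ->
        exists! h : hom (pb1 kz) (pb1 ki), vertical p h /\
          forall m : hom kz ki,
            pbm1 m = h -> pbm2 m ≡ idm (pb2 ki) -> ev ∘ fmap and m = g.

End Connectives.

Inductive nd_generator (P : Cat) (p : Functor P FinSet)
  (and : Functor (Pb p p) P) (top : Functor FinSet P)
  (imp : Functor (Pb (fib_opp p) p) P) (bot : Functor FinSet P) :
  rule_class :=
| gen_classifier : nd_generator and top imp bot p
| gen_and : nd_generator and top imp bot and
| gen_top : nd_generator and top imp bot top
| gen_imp : nd_generator and top imp bot imp
| gen_bot : nd_generator and top imp bot bot.

(* Substitutionality is a condition on the generating data: the classifier is a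
   fibration and the generating rules preserve cartesian arrows (part of
   [fibred_functor]); there are no generating policies.  It cannot be asked of
   every rule of the generated theory: the equalizer of dom, cod on the arrow
   category of [FinSet] yields the judgement "finite sets with an endomap",
   which is not a fibration. *)
Record natural_deduction_theory := {
  nd_P : Cat;
  nd_p : Functor nd_P FinSet;
  nd_fibration : fibration nd_p;
  nd_faithful : faithful nd_p;
  nd_and : Functor (Pb nd_p nd_p) nd_P;
  nd_and_product : fibred_product nd_and;
  nd_top : Functor FinSet nd_P;
  nd_top_terminal : fibred_terminal nd_p nd_top;
  nd_imp : Functor (Pb (fib_opp nd_p) nd_p) nd_P;
  nd_imp_implication : fibred_implication nd_and nd_imp;
  nd_bot : Functor FinSet nd_P;
  nd_bot_initial : fibred_initial nd_p nd_bot;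
  nd_theory : judgemental_theory FinSet;
  nd_generated :
    generated_by nd_theory (nd_generator nd_and nd_top nd_imp nd_bot)
}.

(** * The entailment classifier *)

Section Entailment.
Variables (P ctx : Cat) (p : Functor P ctx).

Definition Ent : Cat := Pb (arr_map p) (arr_const ctx).
Definition ent : Functor Ent ctx := pb_snd (arr_map p) (arr_const ctx).

Definition ent_dom (v : Ent) : P := adom (pb1 v).
Definition ent_cod (v : Ent) : P := acod (pb1 v).
Definition ent_arr (v : Ent) : hom (ent_dom v) (ent_cod v) := aarr (pb1 v).

Lemma ent_dom_over (v : Ent) : p (ent_dom v) = ent v.
Proof. exact: (congr1 (@adom ctx) (pb_eq v)). Qed.

Lemma ent_cod_over (v : Ent) : p (ent_cod v) = ent v.
Proof. exact: (congr1 (@acod ctx) (pb_eq v)). Qed.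

Lemma ent_arr_vertical (v : Ent) : vertical p (ent_arr v).
Proof.
have arrE (x y : Arr ctx) : x = y -> aarr x ≡ aarr y by move=> ->.
apply: (hom_eq_trans (arrE _ _ (pb_eq v))).
exact: hom_eq_id (esym (ent_dom_over v)).
Qed.

End Entailment.

(* Main.v *)
From mathcomp Require Import all_boot.
From Stdlib Require Import ProofIrrelevance.
Require Import Defs.

Set Implicit Arguments.
Unset Strict Implicit.
Unset Printing Implicit Defensive.

(** The tautological arrow [ψ -> φ] on [Ent p] and the identity of [χ] are
    policies, with the same image under [p] because entailments are vertical; so
    they induce a policy between functors into [P ×_ctx P].  Whiskering it with
    [∧] gives a policy with components [ψ ∧ χ -> φ ∧ χ], which classifies a rule
    into [Arr P]; as [∧] lies over [ctx], this rule factors through [Ent p]. *)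

Lemma MkArrOb_hom_eq (C : Cat) (a b c d : C) (f : hom a b) (g : hom c d) :
  f ≡ g -> MkArrOb f = MkArrOb g.
Proof. by case. Qed.

(** The components [am0] and [am1] do not see the arrows [aarr] of the endpoints, hence the separate
    hypotheses [k = k'] and [l = l']. *)
Lemma ArrHom_hom_eq (C : Cat) (k l k' l' : Arr C) (f : hom k l)
    (g : hom k' l') :
  k = k' -> l = l' -> am0 f ≡ am0 g -> am1 f ≡ am1 g -> f ≡ g.
Proof.
move=> ek el; subst k' l' => /hom_eq_eq e0 /hom_eq_eq e1.
by apply: eq_hom_eq; apply: ArrHom_ext.
Qed.

Lemma MkPbOb_irrel (A B X : Cat) (F : Functor A X) (G : Functor B X)
    (a : A) (b : B) (e e' : F a = G b) : MkPbOb e = MkPbOb e'.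
Proof. by rewrite (proof_irrelevance _ e e'). Qed.

Lemma feq_whiskR (A B C D : Cat) (G : Functor C D) (F : Functor B C)
    (H : Functor B D) (K : Functor A B) :
  G ⊚ F ≗ H -> G ⊚ (F ⊚ K) ≗ H ⊚ K.
Proof. by case=> eo em; split=> [a|a b f]; [exact: eo | exact: em]. Qed.

Lemma feq_trans (A B : Cat) (F G H : Functor A B) : F ≗ G -> G ≗ H -> F ≗ H.
Proof.
case=> eo em [eo' em']; split=> [a|a b f]; first by rewrite eo.
exact: hom_eq_trans (em a b f) (em' a b f).
Qed.

(** This is the pullback square defining [Ent p] followed by [arr_dom], since the domain of an
    identity on [x] is [x]. *)
Lemma ent_dom_feq (P ctx : Cat) (p : Functor P ctx) :
  p ⊚ (arr_dom ⊚ pb_fst (arr_map p) (arr_const ctx)) ≗ ent p.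
Proof.
split=> [v|v w m]; first exact: ent_dom_over.
exact: (fmap_hom_eq arr_dom (pbm_eq m)).
Qed.

Lemma ent_cod_feq (P ctx : Cat) (p : Functor P ctx) :
  p ⊚ (arr_cod ⊚ pb_fst (arr_map p) (arr_const ctx)) ≗ ent p.
Proof.
split=> [v|v w m]; first exact: ent_cod_over.
exact: (fmap_hom_eq arr_cod (pbm_eq m)).
Qed.

Lemma pb_feq (A B X : Cat) (F : Functor A X) (G : Functor B X) :
  F ⊚ pb_fst F G ≗ G ⊚ pb_snd F G.
Proof. by split=> [k|k l m]; [exact: pb_eq | exact: pbm_eq]. Qed.

(** The condition for [arr_lift γ] to factor through [Ent p]: by verticality [p] sends each [γ k] to
    the identity on [q k]. *)
Lemma arr_lift_vertical_feq (K P ctx : Cat) (p : Functor P ctx)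
    (F G : Functor K P) (γ : F ⇒ G) (q : Functor K ctx) :
  p ⊚ F ≗ q -> p ⊚ G ≗ q -> (forall k, vertical p (γ k)) ->
  arr_map p ⊚ arr_lift γ ≗ arr_const ctx ⊚ q.
Proof.
move=> [Fo Fm] [Go Gm] vert.
have eo k : (arr_map p ⊚ arr_lift γ) k = (arr_const ctx ⊚ q) k.
  apply: MkArrOb_hom_eq; apply: hom_eq_trans (vert k) _.
  exact: hom_eq_id (Fo k).
split=> // k l m.
by apply: ArrHom_hom_eq; [exact: eo | exact: eo | exact: Fm | exact: Gm].
Qed.

Section RuleF.
Variables (ctx : Cat) (T : judgemental_theory ctx).
Variables (P : Cat) (p : Functor P ctx) (and : Functor (Pb p p) P).
Hypotheses (rule_p : rule T p) (rule_and : rule T and).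
Hypothesis and_over : p ⊚ and ≗ p ⊚ pb_fst p p.

Local Notation K := (Pb (ent p) p).
Local Notation arrE := (pb_fst (arr_map p) (arr_const ctx)).
Local Notation fstK := (pb_fst (ent p) p).
Local Notation sndK := (pb_snd (ent p) p).

(** On [(ψ -> φ, χ)] these give [ψ], [φ] and the arrow between them, composed from projections and
    whiskerings so that the closure conditions apply. *)
Definition premise_dom : Functor K P := arr_dom ⊚ arrE ⊚ fstK.
Definition premise_cod : Functor K P := arr_cod ⊚ arrE ⊚ fstK.
Definition premise_arr : premise_dom ⇒ premise_cod :=
  whiskR (whiskR arr_taut arrE) fstK.

Lemma premise_dom_over : p ⊚ premise_dom ≗ ent p ⊚ fstK.
Proof. exact/feq_whiskR/ent_dom_feq. Qed.

Lemma premise_cod_over : p ⊚ premise_cod ≗ ent p ⊚ fstK.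
Proof. exact/feq_whiskR/ent_cod_feq. Qed.

(** Both sides are identities, on [p ψ] and [p χ], and these objects agree because [ψ -> φ] and [χ]
    lie over the same context. *)
Lemma premise_arr_over (k : K) : fmap p (premise_arr k) ≡ fmap p (idN sndK k).
Proof.
apply: hom_eq_trans (ent_arr_vertical (pb1 k)) _; rewrite /= fmap_id.
by apply: hom_eq_id; rewrite ent_dom_over; exact: pb_eq k.
Qed.

Definition pair_dom : Functor K (Pb p p) :=
  pb_lift (feq_trans premise_dom_over (pb_feq _ _)).
Definition pair_cod : Functor K (Pb p p) :=
  pb_lift (feq_trans premise_cod_over (pb_feq _ _)).
Definition pair_arr : pair_dom ⇒ pair_cod := pb_lift2 _ _ premise_arr_over.
Definition and_arr : and ⊚ pair_dom ⇒ and ⊚ pair_cod := whiskL and pair_arr.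

(** By [and_over], [p] sees only the first component of [pair_arr k], which is the vertical
    entailment. *)
Lemma and_arr_vertical (k : K) : vertical p (and_arr k).
Proof.
apply: hom_eq_trans (proj2 and_over _ _ _) _.
apply: hom_eq_trans (ent_arr_vertical (pb1 k)) _.
apply: hom_eq_id; exact: esym (proj1 and_over (pair_dom k)).
Qed.

Lemma and_arr_feq :
  arr_map p ⊚ arr_lift and_arr ≗ arr_const ctx ⊚ (ent p ⊚ fstK).
Proof.
apply: arr_lift_vertical_feq and_arr_vertical.
- by apply: feq_trans (feq_whiskR _ and_over) _; exact: premise_dom_over.
- by apply: feq_trans (feq_whiskR _ and_over) _; exact: premise_cod_over.
Qed.

Definition ent_and : Functor K (Ent p) := pb_lift and_arr_feq.

Lemma rule_ent_and : rule T ent_and.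
Proof.
have [_ cod cmp id2 _ wL wR] := jt_composition T.
have [cfst csnd clift clift2] := jt_pullbacks T.
have [_ _ ctaut alift _] := jt_arrows T.
have rP : rule T (idF P) := cc_dom (jt_composition T) rule_p.
have rctx : rule T (idF ctx) := cod _ _ _ rule_p.
(* Both legs of the pullback defining [Ent p] classify policies: [p] whiskered with the tautological
   one, and an identity. *)
have rmap : rule T (arr_map p) by apply/alift/wL/ctaut.
have rconst : rule T (arr_const ctx) by apply/alift/id2.
have rarr := cfst _ _ _ _ _ rmap rconst.
have rent : rule T (ent p) := csnd _ _ _ _ _ rmap rconst.
have rfst := cfst _ _ _ _ _ rent rule_p.
apply: clift => //; last exact: cmp.
apply/alift/wL => //; apply: clift2 => //; last exact/id2/csnd.
exact/wR/rfst/wR/rarr/ctaut.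
Qed.

End RuleF.

Theorem lemma4p2p3 (N : natural_deduction_theory) :
  exists f : Functor (Pb (ent (nd_p N)) (nd_p N)) (Ent (nd_p N)),
    rule (nd_theory N) f /\
    ent (nd_p N) ⊚ f ≗ ent (nd_p N) ⊚ pb_fst (ent (nd_p N)) (nd_p N) /\
    forall (v : Ent (nd_p N)) (chi : nd_P N) (hx : ent (nd_p N) v = nd_p N chi),
      ent_dom (f (MkPbOb hx)) =
        nd_and N (MkPbOb (eq_trans (ent_dom_over v) hx)) /\
      ent_cod (f (MkPbOb hx)) =
        nd_and N (MkPbOb (eq_trans (ent_cod_over v) hx)).
Proof.
have [gens _] := nd_generated N.
have [[and_over _] _] := nd_and_product N.
exists (ent_and and_over); split; last split.
- by apply: rule_ent_and; apply: gens; constructor.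
(* The second leg of [pb_lift] is [ent p ⊚ fstK] by computation. *)
- by split.
(* The two pairs under [∧] have the same components and differ only in the proof that these lie over
   one context. *)
- by move=> v chi hx; split; congr (nd_and N _); exact: MkPbOb_irrel.
Qed.
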